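(* Let $p \neq 2$ be a prime and let $e \ge 1$ be an integer. Let $g \in \mathbb{Z}$ be fixed with $p \nmid g$, and let $m$ be the multiplicative order of $g$ modulo $p$. Let $|T_{e,g}|$ denote the number of two-cycles modulo $p^e$ associated with $g$, that is, $|T_{e,g}|$ is one half of the number of integers $h \in \{1, \ldots, p^e m\}$ with $p \nmid h$ such that for some $a \in \{1, \ldots, p^e m\}$ with $p \nmid a$ one has $$h \not\equiv a \pmod{p^e}, \qquad g^h \equiv a \pmod{p^e}, \qquad g^a \equiv h \pmod{p^e}.$$ Then $$|T_{e,g}| = \frac{m^2 - m}{2}.$$
   Context: The factor one half reflects the convention that the two-cycles $(h,a)$ and $(a,h)$ are not distinguished. *)

(* Defs.v *)
From mathcomp Require Import all_boot all_order all_algebra.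

Set Implicit Arguments.
Unset Strict Implicit.
Unset Printing Implicit Defensive.

Import GRing.Theory.
Local Open Scope ring_scope.

Definition two_cycle (p e : nat) (g : int) (h a : nat) : bool :=
  [&& (h%:Z != a%:Z %[mod (p ^ e)%N%:Z])%Z,
      (g ^+ h == a%:Z %[mod (p ^ e)%N%:Z])%Z
    & (g ^+ a == h%:Z %[mod (p ^ e)%N%:Z])%Z].

(* The range {1, ..., p ^ e * m} is the nonzero part of the ordinal type. *)
Definition two_cycle_points (p e : nat) (g : int) (m : nat) :
    {set 'I_(p ^ e * m).+1} :=
  [set h : 'I_(p ^ e * m).+1 |
    [&& (0 < h)%N, ~~ (p %| h)%N &
      [exists a : 'I_(p ^ e * m).+1,
        [&& (0 < a)%N, ~~ (p %| a)%N & two_cycle p e g h a]]]].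

(* Rational-valued, so that one half is an exact division. *)
Definition num_two_cycles (p e : nat) (g : int) (m : nat) : rat :=
  #|two_cycle_points p e g m|%:R / 2%:R.

(* Main.v *)
Require Import Defs.
From mathcomp Require Import all_boot all_order all_algebra.

(** Write [q = p ^ e], and call a pair [(h, a)] linked modulo [q] when
    [g ^ h = a] and [g ^ a = h] modulo [q].  The idea is that linked pairs
    modulo [q * m] are classified by their residues modulo [m]: each of the
    [m ^ 2] pairs of residues [(i, j)] is realised by exactly one linked pair.

    What makes this work is that exponentiation gains one power of [p]
    ([expn_mod_gain]): knowing the exponent modulo [p ^ k * m] determines the
    power modulo [p ^ k.+1].  Since [m] divides [p - 1] it is prime to [p], so
    by the Chinese remainder theorem a pair with prescribed residues modulo [m]
    can be lifted one power of [p] at a time ([linked_exists]), and the same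
    gain shows that two linked pairs with the same residues modulo [m] agree
    modulo every [p ^ k * m], [k <= e] ([linked_unique]).

    The degenerate pairs, those with [h = a] modulo [q], are the ones on the
    diagonal [i = j] ([linked_diag]): exchanging the members of a linked pair
    gives a linked pair, so for [i = j] uniqueness forces [h = a]; conversely
    [g ^ h] determines [h] modulo [m].  This leaves [m ^ 2 - m] linked pairs.
    Finally a linked pair is determined by [h] alone ([linked_fst_inj]), so
    counting pairs is the same as counting their first members. *)

Set Implicit Arguments.
Unset Strict Implicit.
Unset Printing Implicit Defensive.

Import GRing.Theory.

(** * Exponentiation modulo powers of a prime *)

(** The quotient of [x ^ p - 1] by [x - 1] is a sum of [p] powers of [x], hence
    [0] modulo [p] as soon as [x = 1] modulo [p]. *)
Lemma dvdn_exp_prime_pred p k x : 0 < x ->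
  p ^ k.+1 %| x.-1 -> p ^ k.+2 %| (x ^ p).-1.
Proof.
move=> x_gt0 dvd_x; rewrite predn_exp expnSr dvdn_mul //.
have x1 : x = 1 %[mod p].
  apply/eqP; rewrite eqn_mod_dvd // subn1.
  by apply: dvdn_trans dvd_x; rewrite expnS dvdn_mulr.
rewrite /dvdn -modn_summ.
under eq_bigr => i _ do rewrite -modnXm x1 modnXm exp1n.
by rewrite modn_summ sum1_card card_ord modnn.
Qed.

Lemma expn_order_mod p g m k : 0 < g -> g ^ m = 1 %[mod p] ->
  g ^ (p ^ k * m) = 1 %[mod p ^ k.+1].
Proof.
move=> g_gt0 gm1; have gX_gt0 n : 0 < g ^ n by rewrite expn_gt0 g_gt0.
apply/eqP; rewrite eqn_mod_dvd // subn1.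
elim: k => [|k IHk].
  by rewrite mul1n expn1 -subn1 -eqn_mod_dvd // gm1.
by rewrite (expnS p k) -mulnA mulnC expnM dvdn_exp_prime_pred.
Qed.

(** This contraction property drives both the lifting and the uniqueness of
    linked pairs. *)
Lemma expn_mod_gain p g m k a b : 0 < g -> g ^ m = 1 %[mod p] ->
  a = b %[mod p ^ k * m] -> g ^ a = g ^ b %[mod p ^ k.+1].
Proof.
move=> g_gt0 gm1; set M := p ^ k * m => eq_ab.
have red c : g ^ c = g ^ (c %% M) %[mod p ^ k.+1].
  rewrite {1}(divn_eq c M) expnD mulnC [_ * M]mulnC expnM.
  rewrite -modnMmr -modnXm (expn_order_mod k g_gt0 gm1) modnXm exp1n.
  by rewrite modnMmr muln1.
by rewrite red eq_ab -red.
Qed.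

(** * Linked pairs *)

Definition linked q g h a := (g ^ h == a %[mod q]) && (g ^ a == h %[mod q]).

Lemma linkedC q g h a : linked q g h a = linked q g a h.
Proof. by rewrite /linked andbC. Qed.

Section LinkedPairs.

Variables (p g m : nat).
Hypotheses (p_prime : prime p) (p_ndvd_g : ~~ (p %| g)).
(** That [m] is the order of [g], in the form that is used: powers of [g] modulo
    [p] determine, and depend only on, exponents modulo [m]. *)
Hypothesis g_order : forall a b,
  (g ^ a == g ^ b %[mod p]) = (a == b %[mod m]).

Let g_gt0 : 0 < g.
Proof. by case: g p_ndvd_g => //; rewrite dvdn0. Qed.

Let gm1 : g ^ m = 1 %[mod p].
Proof. by apply/eqP; rewrite -(expn0 g) g_order modnn mod0n. Qed.

Let m_dvd : m %| p.-1.
Proof.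
rewrite -subn1 -eqn_mod_dvd ?prime_gt0 // -g_order expn1.
by apply/eqP/fermat_little.
Qed.

Lemma order_gt0 : 0 < m.
Proof. by apply: dvdn_gt0 m_dvd; rewrite -subn1 subn_gt0 prime_gt1. Qed.

Let co_pXm k : coprime (p ^ k) m.
Proof.
apply: coprimeXl; apply: coprime_dvdr m_dvd _.
by apply: coprimenP; apply: prime_gt0.
Qed.

Let eq_mod_pXm k x y :
  x = y %[mod p ^ k] -> x = y %[mod m] -> x = y %[mod p ^ k * m].
Proof. by move=> xy_p xy_m; apply/eqP; rewrite chinese_remainder // xy_p xy_m !eqxx. Qed.

Let eq_mod_dvd d q x y : d %| q -> x = y %[mod q] -> x = y %[mod d].
Proof. by move=> dq xy; rewrite -(modn_dvdm x dq) xy modn_dvdm. Qed.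

Lemma linked_exists e i j :
  exists h a, [/\ h = i %[mod m], a = j %[mod m] & linked (p ^ e) g h a].
Proof.
elim: e => [|k [h [a [hi aj /andP[/eqP gh /eqP ga]]]]].
  by exists i, j; rewrite /linked !modn1.
(* Replacing each member by the power it should equal changes neither residue
   modulo [p ^ k * m], hence preserves both powers modulo [p ^ k.+1]. *)
pose h' := chinese (p ^ k.+1) m (g ^ a) i.
pose a' := chinese (p ^ k.+1) m (g ^ h) j.
have pkS : p ^ k %| p ^ k.+1 by rewrite dvdn_exp2l.
have h'p : h' = g ^ a %[mod p ^ k.+1] by apply: chinese_modl.
have a'p : a' = g ^ h %[mod p ^ k.+1] by apply: chinese_modl.
have h'm : h' = i %[mod m] by apply: chinese_modr.
have a'm : a' = j %[mod m] by apply: chinese_modr.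
have hh' : h' = h %[mod p ^ k * m].
  by apply: eq_mod_pXm; rewrite ?h'm // (eq_mod_dvd pkS h'p).
have aa' : a' = a %[mod p ^ k * m].
  by apply: eq_mod_pXm; rewrite ?a'm // (eq_mod_dvd pkS a'p).
exists h', a'; split=> //; rewrite /linked h'p a'p.
by rewrite (expn_mod_gain g_gt0 gm1 hh') (expn_mod_gain g_gt0 gm1 aa') !eqxx.
Qed.

Lemma linked_unique e h a h' a' :
    linked (p ^ e) g h a -> linked (p ^ e) g h' a' ->
    h = h' %[mod m] -> a = a' %[mod m] ->
  h = h' %[mod p ^ e * m] /\ a = a' %[mod p ^ e * m].
Proof.
move=> /andP[/eqP gh /eqP ga] /andP[/eqP gh' /eqP ga'] hh' aa'.
suff agree k : k <= e ->
    h = h' %[mod p ^ k * m] /\ a = a' %[mod p ^ k * m] by apply: agree.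
elim: k => [|k IHk] ke; first by rewrite mul1n.
have [hk ak] := IHk (ltnW ke).
have pke : p ^ k.+1 %| p ^ e by rewrite dvdn_exp2l.
split; apply: eq_mod_pXm => //.
  rewrite -(eq_mod_dvd pke ga) -(eq_mod_dvd pke ga').
  exact: expn_mod_gain ak.
rewrite -(eq_mod_dvd pke gh) -(eq_mod_dvd pke gh').
exact: expn_mod_gain hk.
Qed.

Section PositiveExponent.

Variable e : nat.
Hypothesis e_gt0 : 0 < e.

Let p_dvd_q : p %| p ^ e. Proof. by rewrite dvdn_exp. Qed.

Lemma linked_ndvd h a : linked (p ^ e) g h a -> ~~ (p %| h).
Proof.
case/andP=> _ /eqP ga; rewrite /dvdn -(eq_mod_dvd p_dvd_q ga).
by rewrite -/(dvdn p _) Euclid_dvdX // negb_and p_ndvd_g.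
Qed.

(** The second member is [g ^ h] modulo [p ^ e], and its residue modulo [m] is
    the discrete logarithm of [h] modulo [p]. *)
Lemma linked_fst_inj h a a' :
  linked (p ^ e) g h a -> linked (p ^ e) g h a' -> a = a' %[mod p ^ e * m].
Proof.
move=> /andP[/eqP gh /eqP ga] /andP[/eqP gh' /eqP ga'].
apply: eq_mod_pXm; first by rewrite -gh gh'.
by apply/eqP; rewrite -g_order; apply/eqP/(eq_mod_dvd p_dvd_q); rewrite ga ga'.
Qed.

Lemma linked_diag h a : linked (p ^ e) g h a ->
  (h == a %[mod p ^ e]) = (h == a %[mod m]).
Proof.
move=> hl; apply/eqP/eqP => [ha|ha]; last first.
  have [|hq _] := linked_unique hl _ ha (esym ha); first by rewrite linkedC.
  by apply: eq_mod_dvd hq; apply: dvdn_mulr.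
case/andP: hl => /eqP gh /eqP ga.
apply/eqP; rewrite -g_order; apply/eqP/(eq_mod_dvd p_dvd_q).
by rewrite gh ga.
Qed.

(** * Counting *)

Let N := p ^ e * m.

Definition proper_pairs : {set 'I_N.+1 * 'I_N.+1} :=
  [set u : 'I_N.+1 * 'I_N.+1 |
    [&& 0 < u.1, 0 < u.2, u.1 != u.2 %[mod p ^ e]
      & linked (p ^ e) g u.1 u.2]].

Let p_dvd_N : p %| N. Proof. exact: dvdn_mulr. Qed.

Let N_gt0 : 0 < N.
Proof. by rewrite muln_gt0 order_gt0 expn_gt0 prime_gt0. Qed.

(** The only two elements of [0..N] that agree modulo [N] are the endpoints, and
    both are multiples of [p]. *)
Let ord_eq_mod (x y : 'I_N.+1) :
  ~~ (p %| x) -> ~~ (p %| y) -> x = y %[mod N] -> x = y.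
Proof.
have small (z : 'I_N.+1) : ~~ (p %| z) -> z %% N = z.
  move=> pz; apply: modn_small; rewrite ltn_neqAle -ltnS ltn_ord andbT.
  by apply: contraNneq pz => ->.
by move=> px py; rewrite !small // => /val_inj.
Qed.

Lemma proper_pairs_fst_inj : {in proper_pairs &, injective fst}.
Proof.
move=> [h a] [h' a']; rewrite !inE /=.
case/and4P=> _ _ _ ha /and4P[_ _ _ ha'] eqh; rewrite -{}eqh in ha' *.
congr (_, _); apply: ord_eq_mod; last exact: linked_fst_inj ha ha'.
  by apply: (@linked_ndvd _ h); rewrite linkedC.
by apply: (@linked_ndvd _ h); rewrite linkedC.
Qed.

Lemma card_proper_pairs : #|proper_pairs| = m ^ 2 - m.
Proof.
pose res x : 'I_m := Ordinal (ltn_pmod x order_gt0).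
pose f (u : 'I_N.+1 * 'I_N.+1) := (res u.1, res u.2).
have f_inj : {in proper_pairs &, injective f}.
  move=> [h a] [h' a']; rewrite !inE /=.
  case/and4P=> _ _ _ ha /and4P[_ _ _ ha'] [eqh eqa].
  have [hh' aa'] := linked_unique ha ha' eqh eqa.
  have nd x y : linked (p ^ e) g x y -> ~~ (p %| x) /\ ~~ (p %| y).
    by move=> xy; split; [|rewrite linkedC in xy]; apply: linked_ndvd xy.
  have [[? ?] [? ?]] := (nd _ _ ha, nd _ _ ha').
  by congr (_, _); apply: ord_eq_mod.
have f_im : f @: proper_pairs = ~: [set (i, i) | i : 'I_m].
  apply/setP=> -[i j]; rewrite inE.
  have -> : ((i, j) \in [set (i, i) | i : 'I_m]) = (i == j).
    apply/imsetP/eqP => [[k _ [-> ->]] // | ->]; by exists j.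
  apply/imsetP/idP => [[[h a]] | neq_ij].
    rewrite inE /= => /and4P[_ _ neq ha] [-> ->].
    by apply: contra neq; rewrite (linked_diag ha) => /eqP[->].
  have [h [a [hi aj ha]]] := linked_exists e i j.
  have ltN x : x %% N < N.+1 by rewrite ltnS ltnW // ltn_pmod.
  have pos x y : linked (p ^ e) g x y -> 0 < x %% N.
    move=> /linked_ndvd; rewrite lt0n; apply: contraNneq => xN.
    by apply: dvdn_trans p_dvd_N _; rewrite /dvdn xN.
  have mod_m x : x %% N %% m = x %% m by rewrite modn_dvdm // dvdn_mull.
  have mod_q x : x %% N %% p ^ e = x %% p ^ e by rewrite modn_dvdm // dvdn_mulr.
  (* Exponents matter modulo [N] only, a consequence of the gain at [k = e]. *)
  have expN x : g ^ (x %% N) = g ^ x %[mod p ^ e].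
    apply: (@eq_mod_dvd _ (p ^ e.+1)); first by rewrite dvdn_exp2l.
    by apply: expn_mod_gain gm1 _ => //; rewrite modn_mod.
  exists (Ordinal (ltN h), Ordinal (ltN a)); last first.
    by congr (_, _); apply: val_inj; rewrite /= mod_m ?hi ?aj modn_small.
  rewrite inE /= (pos _ _ ha) (pos a h) /=; last by rewrite linkedC.
  rewrite /linked !mod_q !expN -/(linked (p ^ e) g h a) ha andbT.
  rewrite (linked_diag ha) hi aj !modn_small //.
rewrite -(card_in_imset f_inj) f_im cardsCs setCK card_prod card_ord mulnn.
by rewrite card_imset ?card_ord // => i j [].
Qed.

End PositiveExponent.

End LinkedPairs.

(** * Two-cycles of an integer base *)

Local Open Scope ring_scope.

Lemma eqz_mod_nat (q x y : nat) :
  (x%:Z == y%:Z %[mod q%:Z])%Z = (x == y %[mod q])%N.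
Proof. by rewrite !modz_nat eqz_nat. Qed.

Lemma natr_Fp_eq p (x y : nat) : prime p ->
  (x%:R == y%:R :> 'F_p) = (x == y %[mod p])%N.
Proof. by move=> p_prime; rewrite -val_eqE /= !val_Fp_nat. Qed.

Lemma intr_Fp_eq p (x y : int) : prime p ->
  (x = y %[mod p%:Z])%Z -> x%:~R = y%:~R :> 'F_p.
Proof.
move=> p_prime /eqP; rewrite eqz_mod_dvd => /dvdzP[c xy].
apply/eqP; rewrite -subr_eq0 -intrB xy intrM.
by rewrite -[p%:Z%:~R]/(p%:R) pchar_Fp_0 // mulr0.
Qed.

Lemma two_cycle_linked p e (g : int) g0 h a :
    (g = g0%:Z %[mod (p ^ e)%N%:Z])%Z ->
  two_cycle p e g h a = (h != a %[mod p ^ e])%N && linked (p ^ e) g0 h a.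
Proof.
move=> gg0; rewrite /two_cycle /linked eqz_mod_nat.
have gX n : (g ^+ n = (g0 ^ n)%N%:Z %[mod (p ^ e)%N%:Z])%Z.
  by rewrite -modzXm gg0 modzXm -[(g0 ^ n)%N%:Z]natz natrX natz.
by rewrite !gX !eqz_mod_nat.
Qed.

Theorem proposition11 (p e : nat) (g : int) (m : nat)
    (p_prime : prime p) (p_neq2 : p <> 2%N) (e_ge1 : (1 <= e)%N)
    (p_ndvd_g : ~~ (p%:Z %| g)%Z)
    (m_order : m.-primitive_root (g%:~R : 'F_p)) :
  num_two_cycles p e g m = (m%:R ^+ 2 - m%:R) / 2%:R :> rat.
Proof.
have q_neq0 : (p ^ e)%N%:Z != 0.
  by rewrite eqz_nat -lt0n expn_gt0 prime_gt0.
(* A natural number in the class of [g], which allows all congruences to be read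
   on natural numbers. *)
pose g0 := `|(g %% (p ^ e)%N%:Z)%Z|%N.
have gg0 : (g = g0%:Z %[mod (p ^ e)%N%:Z])%Z.
  by rewrite /g0 gez0_abs ?modz_ge0 // modz_mod.
have p_dvd_q : (p%:Z %| (p ^ e)%N%:Z)%Z by rewrite dvdzE /= dvdn_exp.
have gg0p : (g = g0%:Z %[mod p%:Z])%Z.
  move/eqP: gg0; rewrite eqz_mod_dvd => /(dvdz_trans p_dvd_q).
  by rewrite -eqz_mod_dvd => /eqP.
have p_ndvd_g0 : ~~ (p %| g0)%N.
  apply: contra p_ndvd_g => p_g0; apply/dvdz_mod0P; rewrite gg0p.
  by apply/dvdz_mod0P; rewrite dvdzE.
have g0_order a b : (g0 ^ a == g0 ^ b %[mod p])%N = (a == b %[mod m])%N.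
  rewrite -natr_Fp_eq // !natrX -[g0%:R]/(g0%:Z%:~R).
  by rewrite -(intr_Fp_eq p_prime gg0p) (eq_prim_root_expr m_order).
have -> : num_two_cycles p e g m = #|proper_pairs p g0 m e|%:R / 2%:R.
  rewrite /num_two_cycles.
  rewrite -(card_in_imset (@proper_pairs_fst_inj _ _ _ p_prime p_ndvd_g0
                             g0_order _ e_ge1)).
  congr (_%:R / _); apply: eq_card => h; rewrite inE.
  apply/and3P/imsetP => [[h_gt0 _ /existsP[a /and3P[a_gt0 _]]] | [[h' a]]].
    rewrite (two_cycle_linked _ _ gg0) => ha.
    by exists (h, a) => //; rewrite inE /= h_gt0 a_gt0.
  rewrite inE /= => /and4P[h_gt0 a_gt0 neq ha] ->.
  have nd := linked_ndvd p_prime p_ndvd_g0 e_ge1.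
  split=> //; first exact: nd ha.
  apply/existsP; exists a; rewrite a_gt0 (two_cycle_linked _ _ gg0) neq ha.
  by rewrite (nd a h') // linkedC.
rewrite (card_proper_pairs p_prime p_ndvd_g0 g0_order e_ge1).
have m_gt0 := order_gt0 p_prime g0_order.
by rewrite natrB ?natrX // -mulnn leq_pmulr.
Qed.
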